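(* Every natural number $x\ge 1$ can be represented in the canonical form of the normalized Mersenne basis in a finite number of steps: the greedy extraction algorithm started at $R_0=x$ reaches remainder $R_n=0$ after finitely many steps $n$, and the resulting expression $x=\sum_{i=1}^{n} a_i M_{k_i}$ (with zero coefficients inserted at the missing indices) is a canonical representation of $x$.
   Context: The normalized Mersenne basis is the sequence of rational numbers $M_k=\frac{2^k-1}{3}$, for integers $k\ge 1$ (so $M_1=1/3$, $M_2=1$, $M_3=7/3$, $M_4=5,\dots$). A canonical representation (canonical form) of a natural number $x\ge 1$ is an expression $x=\sum_{k=1}^{K} a_k M_k$ with $K\ge 1$ and $a_k\in\{0,1,2\}$ satisfying the canonicity condition: for every index $k$ with $1\le k\le K+1$, $$\sum_{j=1}^{k-1} a_j M_j < M_k .$$ Greedy extraction algorithm: put $R_0=x$. At step $i\ge 1$, as long as $R_{i-1}>0$, let $k_i\ge 1$ be the maximal index with $M_{k_i}\le R_{i-1}$, let $a_i=\lfloor R_{i-1}/M_{k_i}\rfloor$, and let $R_i=R_{i-1}-a_iM_{k_i}$. The algorithm stops when the remainder is $0$. In the expression $\sum_{i=1}^{n} a_i M_{k_i}$ the number $a_i$ is the coefficient at index $k_i$; all other indices up to $K=k_1$ get coefficient $0$. *)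

(* Defs.v *)
From mathcomp Require Import all_boot all_order all_algebra.
Set Implicit Arguments.
Unset Strict Implicit.
Unset Printing Implicit Defensive.
Import Order.TTheory GRing.Theory Num.Theory.
Local Open Scope ring_scope.

(* The basis is indexed by k >= 1; mersenne 0 = 0 is not a basis element. *)
Definition mersenne (k : nat) : rat := (2 ^+ k - 1) / 3.

Definition canonical_rep (x K : nat) (a : nat -> nat) : Prop :=
  [/\ (1 <= K)%N,
      forall k, (1 <= k <= K)%N -> (a k <= 2)%N,
      x%:R = \sum_(1 <= k < K.+1) (a k)%:R * mersenne k
    & forall k, (1 <= k <= K.+1)%N ->
        \sum_(1 <= j < k) (a j)%:R * mersenne j < mersenne k].

(* Since k / 3 <= mersenne k, every k with mersenne k <= r is at most 3 r, so
   the search below is exhaustive; see greedy_indexP. The value is 0 when no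
   basis element is <= r. *)
Definition greedy_index (r : rat) : nat :=
  \max_(1 <= k < (Num.truncn (3 * r)).+1 | mersenne k <= r) k.

Definition greedy_coef (r : rat) : nat :=
  Num.truncn (r / mersenne (greedy_index r)).

Definition greedy_next (r : rat) : rat :=
  r - (greedy_coef r)%:R * mersenne (greedy_index r).

(* R_i; past the stopping time the sequence stays at 0. *)
Definition greedy_rem (x i : nat) : rat := iter i greedy_next x%:R.

(* k_i and a_i, for i >= 1. *)
Definition step_index (x i : nat) : nat := greedy_index (greedy_rem x i.-1).
Definition step_coef (x i : nat) : nat := greedy_coef (greedy_rem x i.-1).

Lemma mersenne_ge (k : nat) : k%:R / 3 <= mersenne k.
Proof.
rewrite /mersenne ler_pM2r ?invr_gt0 ?ltr0n // lerBrDr -natr1E -natrX natr1.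
by rewrite ler_nat ltn_expl.
Qed.

Lemma greedy_indexP (r : rat) : mersenne 1 <= r ->
  [/\ (1 <= greedy_index r)%N, mersenne (greedy_index r) <= r
    & forall k, (1 <= k)%N -> mersenne k <= r -> (k <= greedy_index r)%N].
Proof.
move=> r1.
have max k : (1 <= k)%N -> mersenne k <= r -> (k <= greedy_index r)%N.
  move=> k1 kr; rewrite /greedy_index; apply: leq_bigmax_seq => //.
  rewrite mem_index_iota k1 ltnS /= truncn_ge_nat.
    by rewrite mulrC -ler_pdivrMr ?ltr0n // (le_trans (mersenne_ge k)).
  rewrite mulr_ge0 ?ler0n // (le_trans _ kr) // (le_trans _ (mersenne_ge k)) //.
  by rewrite divr_ge0 ?ler0n.
have g1 := max 1%N isT r1; split => //.
move: g1; rewrite /greedy_index.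
apply: (big_ind (fun m => (1 <= m)%N -> mersenne m <= r)) => //.
by move=> m n Hm Hn; rewrite /maxn; case: ifP.
Qed.

(* Main.v *)
Require Import Defs.
From mathcomp Require Import all_boot all_order all_algebra.
From mathcomp Require Import lra.
Set Implicit Arguments.
Unset Strict Implicit.
Unset Printing Implicit Defensive.
Import Order.TTheory GRing.Theory Num.Theory.
Local Open Scope ring_scope.

(* Every remainder is a natural number of thirds.  If k is the greedy index of
   R, maximality of k gives R < M_(k+1) = 2 M_k + 1/3 <= 3 M_k, so the digit is
   at most 2, and the next remainder is < M_k, so indices strictly decrease.
   For each l, the partial sum of the digits below l is one of the remainders
   whose greedy index is < l, hence it is < M_l, again by maximality. *)

Lemma mersenneS (k : nat) : mersenne k.+1 = 2 * mersenne k + 1 / 3.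
Proof. by rewrite /mersenne exprS; lra. Qed.

(** The truncated subtraction is exact because [2 ^ k] is at least 1; this form lets remainders be
    tracked by natural numerators over 3. *)
Lemma mersenne_natE (k : nat) : mersenne k = (2 ^ k - 1)%N%:R / 3.
Proof. by rewrite natrB ?expn_gt0 // natrX. Qed.

Lemma le_mersenne : {homo mersenne : k l / (k <= l)%N >-> k <= l}.
Proof.
move=> k l kl; rewrite /mersenne ler_pM2r ?invr_gt0 ?ltr0n // lerD2r.
by rewrite ler_weXn2l // ler1n.
Qed.

Lemma mersenne_ge_third (k : nat) : (1 <= k)%N -> 1 / 3 <= mersenne k.
Proof. by move=> k1; apply: le_trans (le_mersenne k1); rewrite /mersenne; lra. Qed.

Section GreedyStep.
Variables (m : nat).
Hypothesis m_gt0 : (0 < m)%N.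
Let r : rat := m%:R / 3.

(** Since [mersenne 1] is 1/3, [greedy_indexP] applies to every nonzero number of thirds. *)
Lemma third_ge_mersenne1 : mersenne 1 <= r.
Proof.
have : (1 : rat) <= m%:R by rewrite ler1n.
by rewrite /mersenne /r expr1; lra.
Qed.

Lemma greedy_index_gt0 : (1 <= greedy_index r)%N.
Proof. by have [] := greedy_indexP third_ge_mersenne1. Qed.

Lemma mersenne_greedy_index_le : mersenne (greedy_index r) <= r.
Proof. by have [] := greedy_indexP third_ge_mersenne1. Qed.

Lemma lt_mersenne_above_index (l : nat) :
  (greedy_index r < l)%N -> r < mersenne l.
Proof.
move=> kl; rewrite ltNge; apply/negP => lr.
have [_ _ /(_ l (leq_trans (ltn0Sn _) kl) lr)] :=
  greedy_indexP third_ge_mersenne1.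
by rewrite leqNgt kl.
Qed.

Lemma greedy_coef_itv :
  (greedy_coef r)%:R * mersenne (greedy_index r) <= r
    < (greedy_coef r).+1%:R * mersenne (greedy_index r).
Proof.
have M0 : 0 < mersenne (greedy_index r).
  by apply: lt_le_trans (mersenne_ge_third greedy_index_gt0); lra.
rewrite -ler_pdivlMr // -ltr_pdivrMr //; apply: truncn_itv.
by rewrite divr_ge0 ?(ltW M0) // /r divr_ge0.
Qed.

Lemma greedy_coef_le2 : (greedy_coef r <= 2)%N.
Proof.
have /andP[cr _] := greedy_coef_itv.
have := lt_mersenne_above_index (ltnSn _); rewrite mersenneS => rlt.
have M0 := mersenne_ge_third greedy_index_gt0.
rewrite -ltnS -(ltr_nat rat) -(ltr_pM2r (x := mersenne (greedy_index r))).
  by lra.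
by lra.
Qed.

(** A zero digit would put [r] strictly below the basis element chosen to be at most [r]. *)
Lemma greedy_coef_gt0 : (0 < greedy_coef r)%N.
Proof.
have /andP[_] := greedy_coef_itv; have := mersenne_greedy_index_le.
by case: (greedy_coef r) => // kr; rewrite mul1r ltNge kr.
Qed.

Lemma greedy_next_lt : greedy_next r < mersenne (greedy_index r).
Proof.
have /andP[_] := greedy_coef_itv.
by rewrite /greedy_next -natr1 mulrDl mul1r; lra.
Qed.

(** Multiplying by 3 turns the step into subtraction of the positive natural number
    [greedy_coef r * (2 ^ greedy_index r - 1)] from [m]. The numerator therefore drops strictly,
    which gives termination. *)
Lemma greedy_next_third :
  exists2 m' : nat, (m' < m)%N & greedy_next r = m'%:R / 3.
Proof.
have [d_gt0 cdm] : (0 < 2 ^ greedy_index r - 1)%N /\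
    (greedy_coef r * (2 ^ greedy_index r - 1) <= m)%N.
  split.
    by rewrite subn_gt0 -[X in (X < _)%N](expn0 2) ltn_exp2l // greedy_index_gt0.
  have /andP[+ _] := greedy_coef_itv.
  by rewrite mersenne_natE mulrA ler_pM2r ?invr_gt0 // -natrM ler_nat.
exists (m - greedy_coef r * (2 ^ greedy_index r - 1))%N.
  by rewrite ltn_subrL m_gt0 muln_gt0 greedy_coef_gt0 d_gt0.
by rewrite natrB // natrM /greedy_next mersenne_natE mulrBl mulrA.
Qed.

End GreedyStep.

Definition digits_of (r : rat) (n : nat) (a : nat -> nat) : Prop :=
  (forall i, (i < n)%N ->
     a (greedy_index (iter i greedy_next r)) = greedy_coef (iter i greedy_next r))
  /\ (forall k, (forall i, (i < n)%N ->
        greedy_index (iter i greedy_next r) <> k) -> a k = 0%N).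

(** Strong induction on the numerator, over thirds because remainders of an integer need not be
    integers. The bound of every extracted basis element by [r] separates later indices from the
    leading one; the last clause lets the digits of the next remainder be extended by one leading
    digit. *)
Lemma greedy_expansion (m : nat) : let r : rat := m%:R / 3 in
  exists (n : nat) (a : nat -> nat),
    [/\ iter n greedy_next r = 0,
        forall i, (i < n)%N -> 0 < iter i greedy_next r /\
          mersenne (greedy_index (iter i greedy_next r)) <= r,
        r = \sum_(0 <= i < n) (greedy_coef (iter i greedy_next r))%:R *
              mersenne (greedy_index (iter i greedy_next r)),
        digits_of r n a
      & [/\ forall k, (a k <= 2)%N,
            forall k, (1 <= k)%N ->
              \sum_(1 <= j < k) (a j)%:R * mersenne j < mersenne k
          & forall k, (1 <= k)%N -> r < mersenne k ->
              \sum_(1 <= j < k) (a j)%:R * mersenne j = r]].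
Proof.
elim/ltn_ind: m => m IH r.
have [m0|m_gt0] := posnP m.
  have r0 : r = 0 by rewrite /r m0 mul0r.
  have s0 k : \sum_(1 <= j < k) 0%:R * mersenne j = 0.
    by apply: big1 => j _; rewrite mul0r.
  exists 0%N, (fun=> 0%N); split => //; first by rewrite big_geq.
  split=> // k k1; rewrite s0 //.
  by apply: lt_le_trans (mersenne_ge_third k1); lra.
have [m' m'm r'E] := greedy_next_third m_gt0.
have := IH m' m'm; rewrite /= -r'E -/r.
set r' := greedy_next r; set k := greedy_index r; set c := greedy_coef r.
move=> [n [a [rn0 idx rsum [acoef a0] [a2 alt asum]]]].
have r'k : r' < mersenne k := greedy_next_lt m_gt0.
have rE : r = r' + c%:R * mersenne k by rewrite /r' /greedy_next subrK.
have k_gt0 : (1 <= k)%N := greedy_index_gt0 m_gt0.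
have kr : mersenne k <= r := mersenne_greedy_index_le m_gt0.
have r'r : r' <= r := ltW (lt_le_trans r'k kr).
(* Later basis elements are at most [r'], hence below [mersenne k]. So [a] vanishes at [k], and [b]
   can put [c] there without losing a digit. *)
have idx_ne i : (i < n)%N -> greedy_index (iter i greedy_next r') <> k.
  by move=> /idx[_ le_r' eqk]; move: le_r'; rewrite eqk leNgt r'k.
pose b j := if j == k then c else a j.
have bsum_low l : (l <= k)%N ->
    \sum_(1 <= j < l) (b j)%:R * mersenne j
      = \sum_(1 <= j < l) (a j)%:R * mersenne j.
  move=> lk; apply: eq_big_nat => j /andP[_ jl]; rewrite /b ifN //.
  by rewrite neq_ltn (leq_trans jl lk).
(* Here [r'] is below [mersenne l], so the digits [a] below [l] already sum to [r']; the new digit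
   at [k] contributes the rest of [r]. *)
have bsum_high l : (k < l)%N -> \sum_(1 <= j < l) (b j)%:R * mersenne j = r.
  move=> kl; have r'l := lt_le_trans r'k (le_mersenne (ltnW kl)).
  rewrite rE -(asum l (leq_trans k_gt0 (ltnW kl)) r'l).
  have kin : k \in index_iota 1 l by rewrite mem_index_iota k_gt0.
  rewrite (bigD1_seq k) ?iota_uniq //= [in RHS](bigD1_seq k) ?iota_uniq //=.
  rewrite (a0 k idx_ne) mul0r add0r addrC /b eqxx; congr (_ + _).
  by apply: eq_bigr => j /negPf ->.
exists n.+1, b; split.
- by rewrite iterSr.
- case=> [_|i /idx]; first by split=> //=; rewrite /r divr_gt0 ?ltr0n.
  by rewrite iterSr => -[? le_r']; split=> //; apply: le_trans le_r' r'r.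
- rewrite big_nat_recl //= -/k -/c {1}rE addrC {1}rsum; congr (_ + _).
  by apply: eq_bigr => i _; rewrite -iterS iterSr.
- split=> [[_|i lin]|l nidx].
  + by rewrite /b eqxx.
  + by rewrite iterSr /b ifN ?acoef //; apply/eqP/idx_ne.
  rewrite /b ifN; last by apply/eqP => lk; apply: (nidx 0%N).
  by apply: a0 => i lin; have := nidx i.+1 lin; rewrite iterSr.
- split=> [l|l l1|l l1 rl].
  + by rewrite /b; case: ifP => // _; apply: greedy_coef_le2.
  + have [lk|kl] := leqP l k; first by rewrite bsum_low ?alt.
    by rewrite bsum_high //; apply: lt_mersenne_above_index kl.
  (* If [l] were at most [k], then [mersenne l] would be at most [mersenne k], hence at most [r]. *)
  apply: bsum_high; rewrite ltnNge; apply/negP => /le_mersenne lk.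
  by have := lt_le_trans rl (le_trans lk kr); rewrite ltxx.
Qed.

Theorem theorem5p1 (x : nat) (hx : (1 <= x)%N) :
  exists n : nat,
    [/\ greedy_rem x n = 0,
        forall i, (i < n)%N -> 0 < greedy_rem x i,
        x%:R = \sum_(1 <= i < n.+1)
                 (step_coef x i)%:R * mersenne (step_index x i)
      & exists a : nat -> nat,
          [/\ forall i, (1 <= i <= n)%N -> a (step_index x i) = step_coef x i,
              forall k, (forall i, (1 <= i <= n)%N -> step_index x i <> k) ->
                a k = 0%N
            & canonical_rep x (step_index x 1) a]].
Proof.
have xE : (x * 3)%N%:R / 3 = x%:R :> rat by rewrite natrM mulfK.
have m_gt0 : (0 < x * 3)%N by rewrite muln_gt0 hx.
have := greedy_expansion (x * 3); rewrite /= xE.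
move=> [n [a [rn0 idx xsum [acoef a0] [a2 alt asum]]]].
exists n; split=> //.
- by move=> i /idx[].
- by rewrite big_add1.
exists a; split.
- by case=> // i /acoef.
- by move=> k nidx; apply: a0 => i lin; apply: (nidx i.+1).
split=> [|k _||k /andP[k1 _]]; [|exact: a2| |exact: alt].
- by rewrite /step_index /= -xE greedy_index_gt0.
(* By maximality of the first index, [x] lies below the next basis element, so the digits up to that
   index sum to all of [x]. *)
- by rewrite asum // -xE lt_mersenne_above_index // /step_index /= xE.
Qed.
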